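(* Let $K$ be a field of characteristic $p>0$ and $s\ge1$. For $u\in\mathcal{M}_{n,s}$ let $G_u$ be the ring endomorphism of $\mathcal{D}(P_n)$ with $G_u(a)=a^{p^s}$ for $a\in P_n$ and $G_u(\partial^{[\alpha]})=y_u^{[\alpha]}$ for $\alpha\in\mathbb{N}^n$. Then $u\mapsto G_u$ is a bijection from $\mathcal{M}_{n,s}$ onto $\mathrm{Frob}_s(\mathcal{D}(P_n),\mathcal{D}_n)$, whose inverse is $G\mapsto(u_{ik}(G))$ with $u_{ik}(G)=G(\partial_i^{[p^k]})-\int_i^{*p^s}G(\partial_i^{[p^k-1]})$.
   Context: $P_n=K[x_1,\ldots,x_n]$; $\partial_i^{[k]}=\partial_i^k/k!$ acting on $P_n$ by $\partial_i^{[k]}(x^m)=\binom{m_i}{k}x^{m-ke_i}$; $\partial^{[\alpha]}=\prod_i\partial_i^{[\alpha_i]}$; $\mathcal{D}(P_n)=\bigoplus_\alpha P_n\partial^{[\alpha]}$ is the ring of differential operators and $\mathcal{D}_n=\bigoplus_\alpha K\partial^{[\alpha]}$. $\mathrm{Frob}_s(\mathcal{D}(P_n),\mathcal{D}_n)$ is the set of ring endomorphisms $G$ of $\mathcal{D}(P_n)$ with $G(P_n)\subseteq P_n$, $G(a)=a^{p^s}$ for all $a\in P_n$, and $G(\mathcal{D}_n)\subseteq\mathcal{D}_n$. $\int_i^*:\mathcal{D}_n\to\mathcal{D}_n$ is the $K$-linear map $\partial^{[\alpha]}\mapsto\partial^{[\alpha+e_i]}$, $\int_i^{*p^s}$ its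 $p^s$-th power; $C_s^n=\{\alpha\in\mathbb{N}^n\mid\alpha_i<p^s\}$; $\mathcal{M}_{n,s}$ is the set of matrices $u=(u_{ik})$, $1\le i\le n$, $k\in\mathbb{N}$, with $u_{ik}\in\bigoplus_{0\neq\alpha\in C_s^n}K\partial^{[\alpha]}$. For $u\in\mathcal{M}_{n,s}$: $y_{u,i}^{[0]}=1$, $y_{u,i}^{[1]}=\partial_i^{[p^s]}+u_{i0}$, $y_{u,i}^{[p^k]}=u_{ik}+\int_i^{*p^s}\prod_{l=0}^{k-1}\frac{(y_{u,i}^{[p^l]})^{p-1}}{(p-1)!}$ for $k\ge1$, $y_{u,i}^{[j]}=\prod_k\frac{(y_{u,i}^{[p^k]})^{j_k}}{j_k!}$ for $j=\sum_kj_kp^k$ ($0\le j_k<p$), and $y_u^{[\alpha]}=\prod_iy_{u,i}^{[\alpha_i]}$. *)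

(* Defs.v *)
From HB Require Import structures.
From mathcomp Require Import all_boot all_order all_algebra.
From mathcomp Require Import mpoly.
Set Implicit Arguments. Unset Strict Implicit. Unset Printing Implicit Defensive.
Import Order.TTheory GRing.Theory.
Local Open Scope ring_scope.

(* ------------------------------------------------------------------------
   Encoding.
   P_n = K[x_1..x_n]                    is  {mpoly K[n]}.
   D(P_n) = (+)_alpha P_n d^[alpha]     is  {mpoly {mpoly K[n]}[n]} *as a left
     P_n-module*: the element  sum_alpha a_alpha d^[alpha]  is encoded by the
     "polynomial"  sum_alpha a_alpha 'X_[alpha]  (the monomial 'X_[alpha]
     stands for the basis element d^[alpha]; the coefficient at alpha is a
     polynomial of P_n).  Addition, zero, opposite and the unit 1 = d^[0]
     are those of mpoly; the ring multiplication of D(P_n) is NOT the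
     (commutative) mpoly product but [dmul] below.
   D_n = (+)_alpha K d^[alpha]  = elements all of whose coefficients are
     constant polynomials ([isDn]).
   ------------------------------------------------------------------------ *)

Section DiffOps.
Variables (K : fieldType) (n : nat).

Local Notation P := {mpoly K[n]}.
Local Notation D := {mpoly P[n]}.

(* action of d^[g] on P_n : x^m |-> prod_i binom(m_i, g_i) x^(m-g) *)
Definition dact (g : 'X_{1..n}) (b : P) : P :=
  \sum_(m <- msupp b) (b@_m * (\prod_(i < n) 'C(m i, g i))%:R) *: 'X_[(m - g)%MM].

(* d^[d] d^[b] = (prod_i binom(d_i + b_i, b_i)) d^[d+b] *)
Definition mbin (d b : 'X_{1..n}) : nat := \prod_(i < n) 'C(d i + b i, b i).

(* Multiplication of D(P_n):
   (a d^[al]) (b d^[be]) = sum_{g <= al} a d^[g](b) d^[al-g] d^[be]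
   (divided-power Leibniz rule), extended biadditively. *)
Definition dmul (x y : D) : D :=
  \sum_(a <- msupp x) \sum_(b <- msupp y)
    \sum_(g : 'X_{1..n < (mdeg a).+1} | (bmnm g <= a)%MM)
      ((x@_a * dact g (y@_b)) * (mbin (a - g)%MM b)%:R) *: 'X_[((a - g) + b)%MM].

Definition dexp (x : D) (k : nat) : D := iter k (dmul x) 1.

Definition dscal (c : K) (x : D) : D := (c%:MP) *: x.

Definition dd (i : 'I_n) (m : nat) : D := 'X_i ^+ m.

(* (int_i^* )^k : d^[alpha] |-> d^[alpha + k e_i]  (coefficientwise) *)
Definition intstar (i : 'I_n) (k : nat) (x : D) : D := x * 'X_i ^+ k.

Definition isPn (x : D) : Prop := forall m : 'X_{1..n}, m != 0%MM -> x@_m = 0.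
Definition isDn (x : D) : Prop := forall m : 'X_{1..n}, x@_m = ((x@_m)@_0%MM)%:MP.

Definition Mns (p s : nat) (u : 'I_n -> nat -> D) : Prop :=
  forall i k, isDn (u i k) /\
    forall m : 'X_{1..n}, (u i k)@_m != 0 -> m != 0%MM /\ (forall j, m j < p ^ s)%N.

Section Y.
Variables (p s : nat) (u : 'I_n -> nat -> D) (i : 'I_n).

(* [:: y^[p^0]; y^[p^1]; ...; y^[p^k]] *)
Fixpoint yseq (k : nat) : seq D :=
  if k is k'.+1 then
    let l := yseq k' in
    rcons l (u i k + intstar i (p ^ s)
               (\big[dmul/1]_(y <- l) dscal ((p.-1)`!%:R)^-1 (dexp y p.-1)))
  else [:: dd i (p ^ s) + u i 0].

Definition ypk (k : nat) : D := nth 0 (yseq k) k.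

(* y_{u,i}^[j] = prod_k (y^[p^k])^{j_k} / j_k!,  j_k = k-th base-p digit of j
   (digits of index > j vanish, as p^k > j for k > j) *)
Definition yj (j : nat) : D :=
  \big[dmul/1]_(k < j.+1)
     dscal ((((j %/ p ^ k) %% p)%N)`!%:R)^-1 (dexp (ypk k) ((j %/ p ^ k) %% p)).
End Y.

Definition yalpha (p s : nat) (u : 'I_n -> nat -> D) (a : 'X_{1..n}) : D :=
  \big[dmul/1]_(i < n) yj p s u i (a i).

Definition Gu (p s : nat) (u : 'I_n -> nat -> D) (x : D) : D :=
  \sum_(a <- msupp x) dmul (((x@_a) ^+ (p ^ s))%:MP) (yalpha p s u a).

Definition Frob (p s : nat) (G : D -> D) : Prop :=
  (forall x y, G (x + y) = G x + G y) /\
  (forall x y, G (dmul x y) = dmul (G x) (G y)) /\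
  G 1 = 1 /\
  (forall x, isPn x -> isPn (G x)) /\
  (forall a : P, G (a%:MP) = (a ^+ (p ^ s))%:MP) /\
  (forall x, isDn x -> isDn (G x)).

Definition uG (p s : nat) (G : D -> D) (i : 'I_n) (k : nat) : D :=
  G (dd i (p ^ k)) - intstar i (p ^ s) (G (dd i (p ^ k).-1)).

End DiffOps.

(* Main.v *)
Require Import Defs.
From HB Require Import structures.
From mathcomp Require Import all_boot all_order all_algebra.
From mathcomp Require Import mpoly zify ring.
Set Implicit Arguments. Unset Strict Implicit. Unset Printing Implicit Defensive.
Import Order.TTheory GRing.Theory.
Local Open Scope ring_scope.

(* Put q = p^s. On D(P_n) the commutator with x_j^q sends d^[alpha] to
   d^[alpha - q e_j], since binom(q, k) = 0 in K for 0 < k < q; it is a derivation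
   with right inverse int_j^{*q}, and the elements of D_n killed by all these
   derivations are the combinations of the d^[alpha] with alpha in C_s^n. A ring
   endomorphism extending a |-> a^q thus amounts to commuting systems of divided
   powers y_i^[k] in D_n with [y_i^[k], x_j^q] = y_i^[k-1] if i = j and 0 otherwise.
   In characteristic p such a system is determined by the y_i^[p^k], which may be
   any commuting elements of p-th power 0; D_n is commutative, and an element of
   D_n has p-th power 0 exactly when its constant term vanishes. The commutator
   conditions then say that y_i^[p^k] - int_i^{*q} y_i^[p^k - 1] is killed by all
   the derivations, that is, lies in the span of the d^[alpha], 0 <> alpha in
   C_s^n, and is otherwise arbitrary. *)

(** * Binomial coefficients modulo p *)

Section Binomials.
Variables (K : fieldType) (p : nat) (hp : p \in [pchar K]).

Lemma coef_1DX_exp (R : nzRingType) m a :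
  ((1 + 'X : {poly R}) ^+ m)`_a = 'C(m, a)%:R.
Proof.
elim: m a => [|m IHm] a; first by rewrite expr0 coef1 bin0n eq_sym; case: a.
rewrite exprS mulrDl mul1r coefD coefXM IHm.
by case: a => [|a] /=; rewrite ?addr0 ?bin0 // IHm binS natrD.
Qed.

(** Comparison of the coefficients of X^a in (1+X)^(m+p^s) = (1+X)^m (1+X^(p^s)); the boolean factor
    discards the truncated difference when a < p^s. *)
Lemma bin_addn_pexp s m a :
  'C(m + p ^ s, a)%:R = 'C(m, a)%:R + ('C(m, a - p ^ s) * (p ^ s <= a))%:R :> K.
Proof.
rewrite -!coef_1DX_exp exprD (@exprDn_pchar _ _ _ (p ^ s)); last first.
  rewrite pnatX; apply/orP; left; rewrite pnatE ?(pcharf_prime hp) //.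
  by rewrite pchar_poly.
rewrite expr1n mulrDr mulr1 coefD coefMXn coef_1DX_exp; congr (_ + _).
by case: ltnP => _; rewrite ?muln0 ?muln1 // coef_1DX_exp.
Qed.

(** Induction on [a]: by [bin_addn_pexp] at exponent 1, adding p to the upper index acts on the
    higher digit by Pascal's rule. *)
Lemma Lucas_step a b r t : (r < p)%N -> (t < p)%N ->
  'C(a * p + r, b * p + t)%:R = ('C(a, b) * 'C(r, t))%:R :> K.
Proof.
move=> ltrp lttp; have p_gt0 := prime_gt0 (pcharf_prime hp).
elim: a b => [|a IHa] b.
  case: b => [|b]; first by rewrite mul1n.
  by rewrite bin0n mul0n bin_small //; lia.
have -> : (a.+1 * p + r = (a * p + r) + p ^ 1)%N by rewrite expn1; lia.
rewrite bin_addn_pexp IHa expn1; case: b => [|b].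
  by rewrite leqNgt lttp muln0 addr0 !bin0.
have -> : (b.+1 * p + t - p = b * p + t)%N by lia.
have -> : (p <= b.+1 * p + t)%N by lia.
by rewrite muln1 IHa binS mulnDl natrD.
Qed.

(** The exponent k is the p-adic valuation of j: [Lucas_step] strips common factors p from both
    indices until the upper one is prime to p and the lower one is 1. *)
Lemma exists_pexp_bin_neq0 j : (0 < j)%N ->
  exists2 k, (p ^ k <= j)%N & 'C(j, p ^ k)%:R != 0 :> K.
Proof.
have p_gt1 := prime_gt1 (pcharf_prime hp).
have [m] := ubnP j; elim: m j => // m IHm j ltjm j_gt0.
have [/dvdnP[j' def_j]|Np_j] := boolP (p %| j)%N; last first.
  by exists 0%N; rewrite ?expn0 // bin1 -(dvdn_pcharf hp).
have [||k le_k nz_k] := IHm j'; [nia | nia |].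
exists k.+1; first by rewrite expnS def_j mulnC leq_mul2r le_k orbT.
rewrite def_j expnSr -[(j' * p)%N]addn0 -[X in 'C(_, X)]addn0.
by rewrite Lucas_step ?muln1 //; lia.
Qed.

Lemma natf_fact_neq0 d : (d < p)%N -> d`!%:R != 0 :> K.
Proof.
move=> ltdp; rewrite -(dvdn_pcharf hp).
elim: d ltdp => [|d IHd] ltdp.
  by rewrite dvdn1; case: eqP (pcharf_prime hp) => // ->.
rewrite factS Euclid_dvdM ?(pcharf_prime hp) // negb_or IHd ?(ltnW ltdp) //.
by rewrite andbT gtnNdvd.
Qed.

End Binomials.

(** * Systems of divided powers and base-p digits *)

Section DividedPowers.
Variables (K : fieldType) (p : nat) (hp : p \in [pchar K]) (R : algType K).
Implicit Types (y Y : nat -> R).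

Definition divided_powers y :=
  y 0 = 1 /\ forall j k, y j * y k = y (j + k)%N *+ 'C(j + k, j).

(** The number N of digits read is a free parameter, so that inductions can strip the lowest digit
    and pass to the shifted sequence [Y \o S]. *)
Definition digit_prod Y N j : R :=
  \prod_(k < N) (((j %/ p ^ k) %% p)`!%:R^-1 *: Y k ^+ ((j %/ p ^ k) %% p)).

Let p_pr := pcharf_prime hp.
Let p_gt1 := prime_gt1 p_pr.
Let p_gt0 := prime_gt0 p_pr.

Lemma digit_prodS Y N j :
  digit_prod Y N.+1 j =
    ((j %% p)`!%:R^-1 *: Y 0 ^+ (j %% p)) * digit_prod (Y \o S) N (j %/ p).
Proof.
rewrite /digit_prod big_ord_recl expn0 divn1; congr (_ * _).
by apply: eq_bigr => k _; rewrite /= expnS divnMA.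
Qed.

Lemma digit_prod0 Y N : digit_prod Y N 0 = 1.
Proof.
by rewrite /digit_prod big1 // => k _; rewrite div0n mod0n expr0 invr1 scale1r.
Qed.

Lemma digit_prod_widen Y N M j : (j < p ^ N)%N -> (N <= M)%N ->
  digit_prod Y N j = digit_prod Y M j.
Proof.
elim: N M Y j => [|N IHN] M Y j ltj leNM.
  have -> : j = 0%N by rewrite expn0 in ltj; lia.
  by rewrite !digit_prod0.
case: M leNM => // M leNM; rewrite !digit_prodS (IHN M) //.
by rewrite ltn_divLR // -expnSr.
Qed.

Lemma digit_prod_pexp Y k N : (k < N)%N -> digit_prod Y N (p ^ k) = Y k.
Proof.
elim: N k Y => // N IHN [|k] Y ltkN; rewrite digit_prodS.
  by rewrite expn0 modn_small // divn_small // digit_prod0 mulr1 invr1 scale1r.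
by rewrite expnSr modnMl mulnK // IHN // expr0 invr1 scale1r mul1r.
Qed.

(** All N base-p digits of p^N - 1 equal p - 1; this is the product under the integral in the
    recursion for y^[p^N]. *)
Lemma digit_prod_pexp_pred Y N :
  digit_prod Y N (p ^ N).-1 = \prod_(k < N) ((p.-1)`!%:R^-1 *: Y k ^+ p.-1).
Proof.
elim: N Y => [|N IHN] Y; first by rewrite /digit_prod !big_ord0.
have q_gt0 : (0 < p ^ N)%N by rewrite expn_gt0 p_gt0.
have -> : (p ^ N.+1).-1 = ((p ^ N).-1 * p + p.-1)%N by rewrite expnS; nia.
rewrite digit_prodS modnMDl modn_small ?prednK // divnMDl // divn_small ?prednK //.
by rewrite addn0 IHN big_ord_recl.
Qed.

Lemma comm_digit_prod (w : R) Y N j :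
    (forall k, (k < N)%N -> w * Y k = Y k * w) ->
  w * digit_prod Y N j = digit_prod Y N j * w.
Proof.
move=> cwY; apply: commr_prod => k _; have := cwY _ (ltn_ord k).
by rewrite /GRing.comm -scalerAr -scalerAl => /(commrX _) ->.
Qed.

(** Induction on the digits. Without a carry in the lowest digit, the factorials combine into the
    low binomial of [Lucas_step]. With a carry, the left side contains a power of Y 0 of exponent at
    least p, and the binomial on the right is 0 in K. *)
Lemma digit_prodM Y N j k :
    (forall k l, Y k * Y l = Y l * Y k) -> (forall k, Y k ^+ p = 0) ->
    (j + k < p ^ N)%N ->
  digit_prod Y N j * digit_prod Y N k = digit_prod Y N (j + k) *+ 'C(j + k, j).
Proof.
elim: N Y j k => [|N IHN] Y j k cY Yp0 ltjk.
  have [-> ->] : j = 0%N /\ k = 0%N by rewrite expn0 in ltjk; lia.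
  by rewrite !digit_prod0 mulr1.
rewrite !digit_prodS.
set Z := Y \o S; set j0 := (j %% p)%N; set k0 := (k %% p)%N.
have ltj0 : (j0 < p)%N by rewrite ltn_mod.
have ltk0 : (k0 < p)%N by rewrite ltn_mod.
set j1 := (j %/ p)%N; set k1 := (k %/ p)%N.
have def_j : j = (j1 * p + j0)%N by rewrite -divn_eq.
have def_k : k = (k1 * p + k0)%N by rewrite -divn_eq.
have cZ : Y 0 ^+ k0 * digit_prod Z N j1 = digit_prod Z N j1 * Y 0 ^+ k0.
  by apply/esym/commrX/commr_sym/comm_digit_prod => l _; apply: cY.
rewrite -!scalerAl -!scalerAr -[_ * _ * (_ * _)]mulrA.
rewrite [digit_prod Z N j1 * _]mulrA -cZ !mulrA -exprD -mulrA.
rewrite -scaler_nat -[X in 'C(_, X)]/j.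
have [lt_p|ge_p] := ltnP (j0 + k0)%N p.
  have def_jk : (j + k = (j1 + k1) * p + (j0 + k0))%N by lia.
  rewrite def_jk modnMDl modn_small // divnMDl // divn_small // addn0 {1}def_j.
  rewrite (Lucas_step hp) // IHN; first last.
  - rewrite -(ltn_pmul2r p_gt0) -expnSr; lia.
  - by move=> l; apply: Yp0.
  - by move=> l l'; apply: cY.
  rewrite -!scaler_nat -!scalerAr !scalerA; congr (_ *: _).
  have := bin_fact (leq_addr k0 j0); rewrite addKn => /(congr1 (fun z => z%:R : K)).
  rewrite !natrM => <-.
  have nz0 := natf_fact_neq0 hp ltj0; have nz1 := natf_fact_neq0 hp ltk0.
  have nz2 := natf_fact_neq0 hp lt_p.
  have nzC : 'C(j0 + k0, j0)%:R != 0 :> K.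
    by move: nz2; rewrite -(bin_fact (leq_addr k0 j0)) natrM mulf_eq0 negb_or; case/andP.
  move: nz0 nz1 nzC; move: (j0`!%:R : K) (k0`!%:R : K) ('C(_, j0)%:R : K).
  by move: ('C(_, j1)%:R : K) => c a b d nz_a nz_b nz_d; field; rewrite nz_a nz_b nz_d.
(* Carry: j0 + k0 - p < j0 since k0 < p, so the low binomial is 0. *)
have def_jk : (j + k = (j1 + k1).+1 * p + (j0 + k0 - p))%N by lia.
rewrite def_jk {1}def_j (Lucas_step hp) //; last lia.
rewrite [in 'C(_, j0)]bin_small ?muln0 ?scale0r; last lia.
by rewrite -(subnK ge_p) exprD Yp0 mulr0 mul0r !scaler0.
Qed.

Lemma divided_powers_digit_prod Y :
    (forall k l, Y k * Y l = Y l * Y k) -> (forall k, Y k ^+ p = 0) ->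
  divided_powers (fun j => digit_prod Y j.+1 j).
Proof.
move=> cY Yp0; split=> [|j k]; first exact: digit_prod0.
have lt_pexp N : (N < p ^ N.+1)%N by apply: (ltn_trans (ltn_expl N p_gt1)); rewrite ltn_exp2l.
rewrite (@digit_prod_widen Y j.+1 (j + k).+1 j) ?ltnS ?leq_addr //.
rewrite (@digit_prod_widen Y k.+1 (j + k).+1 k) ?ltnS ?leq_addl //.
exact: digit_prodM.
Qed.

Lemma divided_powers_exp y j : divided_powers y -> y 1%N ^+ j = y j *+ j`!.
Proof.
case=> y0 yM; elim: j => [|j IHj]; first by rewrite expr0 y0.
by rewrite exprS IHj mulrnAr yM bin1 add1n -mulrnA factS.
Qed.

(** With j0 = j mod p, the lowest digit contributes y 1 ^ j0 / j0! = y j0. The other digits are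
    governed by k |-> y (k p), again a system of divided powers by [Lucas_step]. The two parts
    multiply to y j because 'C(j, j0) = 1 in K. *)
Lemma divided_powers_digits y N j : divided_powers y -> (j < p ^ N)%N ->
  y j = digit_prod (fun k => y (p ^ k)%N) N j.
Proof.
elim: N y j => [|N IHN] y j dpy ltj.
  have -> : j = 0%N by rewrite expn0 in ltj; lia.
  by rewrite digit_prod0 dpy.1.
have ltj0 : (j %% p < p)%N by rewrite ltn_mod.
rewrite digit_prodS expn0 divided_powers_exp // -scaler_nat scalerA mulVf; last first.
  exact: (natf_fact_neq0 hp).
rewrite scale1r; pose z k := y (k * p)%N.
have dpz : divided_powers z.
  split=> [|a b]; first by rewrite /z mul0n dpy.1.
  rewrite /z dpy.2 -mulnDl -[RHS]scaler_nat -[LHS]scaler_nat; congr (_ *: _).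
  rewrite -[((a + b) * p)%N]addn0 -[X in 'C(_, X)]addn0.
  by rewrite (Lucas_step hp) ?muln1.
have -> : digit_prod ((fun k => y (p ^ k)%N) \o S) N (j %/ p) = z (j %/ p)%N.
  rewrite (IHN z) //; last by rewrite ltn_divLR // -expnSr.
  by apply: eq_bigr => k _ /=; rewrite /z expnSr.
rewrite /z dpy.2 addnC -divn_eq -[RHS]scaler_nat {2}(divn_eq j p).
rewrite -[X in 'C(_, X)](add0n (j %% p)%N) -(mul0n p) (Lucas_step hp) //.
by rewrite bin0 binn scale1r.
Qed.

(* The commutator with [w] is a derivation, and it lowers the index of a
   divided power as soon as it does so for the indices [p ^ k]: any other
   [y j] is, up to a unit, a product of divided powers of smaller index. *)
Lemma divided_powers_commutator y w :
    divided_powers y ->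
    (forall k, y (p ^ k)%N * w = w * y (p ^ k)%N + y (p ^ k).-1) ->
  forall j, (0 < j)%N -> y j * w = w * y j + y j.-1.
Proof.
move=> [y0 yM] yw j; have [m] := ubnP j; elim: m j => // m IHm j ltjm j_gt0.
have [k le_k nz_k] := exists_pexp_bin_neq0 hp j_gt0.
have q_gt0 : (0 < p ^ k)%N by rewrite expn_gt0 p_gt0.
have [eq_j|ne_j] := eqVneq j (p ^ k)%N; first by rewrite eq_j yw.
set a := (p ^ k)%N in le_k nz_k ne_j q_gt0; pose b := (j - a)%N.
have [b_gt0 ltb lta] : [/\ (0 < b)%N, (b < j)%N & (a < j)%N] by rewrite /b; split; lia.
have def_j : j = (a + b)%N by rewrite /b; lia.
have yab : y a * y b = 'C(j, a)%:R *: y j by rewrite yM -def_j scaler_nat.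
apply: (scalerI nz_k); rewrite scalerAl -yab -mulrA (IHm b) //; last lia.
rewrite mulrDr mulrA (IHm a) //; last lia.
rewrite mulrDl -mulrA yab -scalerAr scalerDr -!addrA; congr (_ + _).
(* Both remaining products are multiples of y (j-1), with binomials that Pascal's rule adds up to
   'C(j, a). *)
rewrite !yM; have -> : (a.-1 + b = j.-1)%N by lia.
have -> : (a + b.-1 = j.-1)%N by lia.
rewrite -mulrnDr scaler_nat; congr (_ *+ _).
by rewrite -{3}(prednK j_gt0) -{3}(prednK q_gt0) binS prednK // addnC.
Qed.

End DividedPowers.

(** * The ring of differential operators *)

Section MPolySums.
Variables (n : nat) (R : nzRingType).
Implicit Types x y : {mpoly R[n]}.

Lemma mpoly_add_ind (P : {mpoly R[n]} -> Prop) :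
    (forall x y, P x -> P y -> P (x + y)) ->
    (forall c m, P (c *: 'X_[m])) ->
  forall x, P x.
Proof.
move=> PD PX; elim/mpolyind => [|c m x _ _]; last exact: PD.
by rewrite -(scale0r 'X_[0%MM]).
Qed.

Variables (V : zmodType) (F : 'X_{1..n} -> R -> V).
Hypothesis FD : forall m, {morph F m : c d / c + d}.

Let F0 m : F m 0 = 0.
Proof. by apply: (addrI (F m 0)); rewrite -FD !addr0. Qed.

(** [dact], [dmul] and [Gu] are built from sums of this shape. When F is additive in the
    coefficient, so is [msum] in x, and identities can be checked on single terms. *)
Definition msum x := \sum_(m <- msupp x) F m x@_m.

Lemma msum_sub (s : seq 'X_{1..n}) x : uniq s -> {subset msupp x <= s} ->
  msum x = \sum_(m <- s) F m x@_m.
Proof.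
move=> uniq_s sub_s; rewrite /msum [RHS](bigID (mem (msupp x))) /=.
rewrite [X in _ + X]big1 => [|m]; last by move/memN_msupp_eq0 ->.
rewrite addr0 -[RHS]big_filter; apply: perm_big.
apply: uniq_perm; rewrite ?msupp_uniq ?filter_uniq // => m.
by rewrite mem_filter andb_idr // => /sub_s.
Qed.

Lemma msumD : {morph msum : x y / x + y}.
Proof.
move=> x y; pose s := undup (msupp x ++ msupp y).
have uniq_s : uniq s by apply: undup_uniq.
rewrite !(msum_sub uniq_s) => [||m|m].
- by rewrite -big_split; apply: eq_bigr => m _; rewrite mcoeffD FD.
- by move=> m my; rewrite mem_undup mem_cat my orbT.
- by move=> mx; rewrite mem_undup mem_cat mx.
- by rewrite mem_undup; apply: msuppD_le.
Qed.

Lemma msumZX c k : msum (c *: 'X_[k]) = F k c.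
Proof.
rewrite (@msum_sub [:: k]) ?big_seq1 ?mcoeffZ ?mcoeffX ?eqxx ?mulr1 //.
by move=> m /msuppZ_le; rewrite msuppX.
Qed.

End MPolySums.

Lemma msum_split n (R : nzRingType) (V : zmodType)
    (F F1 F2 : 'X_{1..n} -> R -> V) (x : {mpoly R[n]}) :
  (forall m c, F m c = F1 m c + F2 m c) -> msum F x = msum F1 x + msum F2 x.
Proof. by move=> FD; rewrite /msum -big_split; apply: eq_bigr. Qed.

Lemma mnm_neq0 (n : nat) (m : 'X_{1..n}) : m != 0%MM -> exists i, m i != 0%N.
Proof.
move=> nz_m; apply/existsP; apply: contraR nz_m; rewrite negb_exists => /forallP m0.
by apply/eqP/mnmP => i; rewrite mnm0E; apply/eqP; rewrite -[_ == _]negbK m0.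
Qed.

Lemma lem_U1n (n : nat) (m : 'X_{1..n}) i q : (U_(i) *+ q <= m)%MM = (q <= m i)%N.
Proof.
apply/mnm_lepP/idP => [/(_ i)|le_q l]; first by rewrite mulmnE mnm1E eqxx mul1n.
by rewrite mulmnE mnm1E; case: eqP => [<-|] //; rewrite mul1n.
Qed.

Lemma mpolyX_ind (n : nat) (R : comNzRingType) (P : {mpoly R[n]} -> Prop) :
    (forall x y, P x -> P y -> P (x + y)) ->
    (forall c, P c%:MP) ->
    (forall i x, P x -> P ('X_i * x)) ->
  forall x, P x.
Proof.
move=> PD PC PX; apply: mpoly_add_ind => // c m.
have [N] := ubnP (mdeg m); elim: N m => // N IHN m ltmN.
have [->|nz_m] := eqVneq m 0%MM; first by rewrite mpolyX0 alg_mpolyC.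
have [i nz_mi] := mnm_neq0 nz_m.
have le_im : (U_(i) <= m)%MM by rewrite lep1mP.
rewrite -(submK le_im) addmC mpolyXD scalerAr; apply/PX/IHN.
by move: ltmN; rewrite -{1}(submK le_im) mdegD mdeg1 addn1.
Qed.

Lemma mcoeffMXn (n : nat) (R : nzRingType) (x : {mpoly R[n]}) m k :
  (x * 'X_[m])@_k = x@_(k - m)%MM *+ (m <= k)%MM.
Proof.
have [le_mk|Nle_mk] := boolP (m <= k)%MM.
  by rewrite -{1}(submK le_mk) addmC mcoeffMX.
apply/memN_msupp_eq0; apply: contra Nle_mk.
by rewrite (perm_mem (msuppMX x m)) => /mapP[m' _ ->]; apply: lem_addr.
Qed.

(** Both sides are m! / (h! g! (m-h-g)!) if h + g <= m, and 0 otherwise. *)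
Lemma bin_mul_bin m h g : ('C(m, h) * 'C(m - h, g) = 'C(h + g, h) * 'C(m, h + g))%N.
Proof.
have [lt_mh|le_hm] := ltnP m h.
  by rewrite (bin_small lt_mh) (@bin_small m (h + g)) ?muln0 // ltn_addr.
have [lt_mg|le_gm] := ltnP (m - h) g.
  by rewrite (bin_small lt_mg) (@bin_small m (h + g)) ?muln0 // -ltn_subLR.
have le_hgm : (h + g <= m)%N by lia.
apply/eqP; rewrite -(eqn_pmul2r (_ : 0 < h`! * (g`! * (m - h - g)`!))%N); last first.
  by rewrite !muln_gt0 !fact_gt0.
rewrite mulnACA (bin_fact le_gm) -mulnA (bin_fact le_hm).
have := bin_fact (leq_addr g h); rewrite addKn => e.
have := bin_fact le_hgm; rewrite -e subnDA => e'.
by rewrite -e'; lia.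
Qed.

(** * Action on polynomials and associativity of the product *)

Section Operators.
Variables (K : fieldType) (n : nat).
Local Notation P := {mpoly K[n]}.
Local Notation D := {mpoly P[n]}.
Implicit Types (a b c : P) (x y z : D) (g h m : 'X_{1..n}).

Let mbinom m g : nat := \prod_(i < n) 'C(m i, g i).

Lemma mbinom_eq0 m g : ~~ (g <= m)%MM -> mbinom m g = 0%N.
Proof.
rewrite negb_forall => /existsP[i]; rewrite -ltnNge => lt_i.
by rewrite /mbinom (bigD1 i) //= bin_small.
Qed.

Lemma dactE g b : dact g b =
  msum (fun m (c : K) => (c * (mbinom m g)%:R) *: 'X_[m - g] : P) b.
Proof. by []. Qed.

Lemma dactD g : {morph @dact K n g : b c / b + c}.
Proof. by move=> b c; rewrite !dactE msumD // => m d e; rewrite mulrDl scalerDl. Qed.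

Lemma dactZX g (c : K) m : dact g (c *: 'X_[m]) = (c * (mbinom m g)%:R) *: 'X_[m - g].
Proof. by rewrite dactE msumZX // => k d e; rewrite mulrDl scalerDl. Qed.

Lemma dactC g (c : K) : dact g c%:MP = c%:MP *+ (g == 0%MM).
Proof.
rewrite -alg_mpolyC -mpolyX0 dactZX sub0m mpolyX0 alg_mpolyC.
have [->|nz_g] := eqVneq.
  by rewrite /mbinom big1 ?mulr1 ?alg_mpolyC // => i _; rewrite mnm0E bin0.
rewrite mbinom_eq0 ?mulr0 ?scale0r //; apply: contra nz_g => /mnm_lepP le_g0.
by apply/eqP/mnmP => i; have := le_g0 i; rewrite mnm0E leqn0 => /eqP.
Qed.

(** The condition on q is Pascal's rule with step q. It holds for q = 1, which serves the Leibniz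
    rule, and in characteristic p for q = p^s, which serves the commutators with x_j^(p^s). *)
Lemma dact_mulXn (q : nat) g (j : 'I_n) b :
    (forall k l : nat, 'C(k + q, l)%:R = 'C(k, l)%:R + ('C(k, l - q) * (q <= l))%:R :> K) ->
  dact g ('X_j ^+ q * b) =
    'X_j ^+ q * dact g b + dact (g - U_(j) *+ q) b *+ (q <= g j).
Proof.
move=> binq; elim/mpoly_add_ind: b => [b c IHb IHc|c m].
  by rewrite mulrDr !dactD IHb IHc mulrDr mulrnDl addrACA.
rewrite mpolyXn -scalerAr -mpolyXD !dactZX.
have E i k : (U_(j) *+ q + k)%MM i = (k i + (j == i) * q)%N.
  by rewrite mnmDE mulmnE mnm1E addnC.
have EB i k : (k - U_(j) *+ q)%MM i = (k i - (j == i) * q)%N.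
  by rewrite mnmBE mulmnE mnm1E.
have -> : (mbinom (U_(j) *+ q + m) g)%:R =
    (mbinom m g)%:R + (mbinom m (g - U_(j) *+ q)%MM * (q <= g j))%:R :> K.
  have Bj k l : mbinom k l = ('C(k j, l j) * \prod_(i < n | i != j) 'C(k i, l i))%N.
    by rewrite /mbinom (bigD1 j).
  rewrite !Bj E EB eqxx mul1n natrM binq mulrDl -!natrM.
  congr (_ + _); first last.
    rewrite -!mulnA [((q <= _) * _)%N]mulnC; congr (_ * (_ * _))%:R.
    by apply: eq_bigr => i ne_ij; rewrite E EB eq_sym (negPf ne_ij) addn0 subn0.
  congr (_ * _)%:R.
  by apply: eq_bigr => i ne_ij; rewrite E eq_sym (negPf ne_ij) addn0.
rewrite mulrDr scalerDl; congr (_ + _).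
  have [le_gm|Nle_gm] := boolP (g <= m)%MM.
    by rewrite -scalerAr -mpolyXD addmBA.
  by rewrite mbinom_eq0 // mulr0 !scale0r mulr0.
case: leqP => [le_q|_]; last by rewrite muln0 mulr0 scale0r.
by rewrite muln1 submBA 1?addmC // lem_U1n.
Qed.

(* The Taylor expansion [b(x + t)]: its coefficient at [t ^ g] is [dact g b], so
   the Leibniz rule becomes the product formula for coefficients. *)
Definition taylor : P -> D :=
  mmap (@mpolyC n P \o @mpolyC n K) (fun i => ('X_i)%:MP + 'X_i).

Lemma taylorD : {morph taylor : b c / b + c}.
Proof. exact: mmapD. Qed.

Lemma taylorM : {morph taylor : b c / b * c}.
Proof. exact: rmorphM. Qed.

Lemma taylorC (c : K) : taylor c%:MP = c%:MP%:MP.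
Proof. exact: mmapC. Qed.

Lemma taylorX i : taylor 'X_i = ('X_i)%:MP + 'X_i.
Proof. by rewrite /taylor mmapX mmap1U. Qed.

Lemma mcoeff_taylor b g : (taylor b)@_g = dact g b.
Proof.
elim/mpolyX_ind: b g => [b c IHb IHc|c|i b IHb] g.
- by rewrite dactD -IHb -IHc taylorD mcoeffD.
- by rewrite taylorC mcoeffC dactC eq_sym mulr_natr.
rewrite taylorM taylorX mulrDl mcoeffD mcoeffCM IHb ['X_i * taylor b]mulrC mcoeffMXn IHb lep1mP.
rewrite -['X_i in RHS]expr1 dact_mulXn ?expr1 ?mulm1n ?lt0n // => m [|a].
  by rewrite !bin0 muln0 addr0.
by rewrite addn1 binS subn1 muln1 natrD.
Qed.

Lemma dactM g b c :
  dact g (b * c) = \sum_(h : 'X_{1..n < (mdeg g).+1} | (bmnm h <= g)%MM)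
                     dact h b * dact (g - h)%MM c.
Proof.
rewrite -mcoeff_taylor taylorM.
rewrite [LHS](@mcoeff_poly_mul_lin _ _ (taylor b) (taylor c) g (mdeg g).+1) //.
by apply: eq_bigr => h _; rewrite -!mcoeff_taylor.
Qed.

Lemma dact_dact g h b : dact g (dact h b) = dact (g + h)%MM b *+ mbin g h.
Proof.
elim/mpoly_add_ind: b => [b c IHb IHc|c m]; first by rewrite !dactD IHb IHc mulrnDl.
rewrite !dactZX submDA addmC -scaler_nat scalerA; congr (_ *: _).
rewrite -mulrA [RHS]mulrCA -!natrM /mbinom /mbin -!big_split /=.
congr (_ * _%:R); apply: eq_bigr => i _; rewrite mnmBE mnmDE.
by rewrite bin_mul_bin // addnC.
Qed.

(* The action of D(P_n) on P_n is faithful and turns [dmul] into composition,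
   whence the associativity of [dmul]. *)
Definition act x b : P := msum (fun m c => c * dact m b) x.

Lemma actDl x y b : act (x + y) b = act x b + act y b.
Proof. by rewrite /act msumD // => m c d; apply: mulrDl. Qed.

Lemma actZX c m b : act (c *: 'X_[m]) b = c * dact m b.
Proof. by rewrite /act msumZX // => k d e; apply: mulrDl. Qed.

Lemma actDr x b c : act x (b + c) = act x b + act x c.
Proof. by apply: msum_split => m a; rewrite dactD mulrDr. Qed.

(** A nonzero operator z does not kill x^m for m the least monomial of its support: d^[k] x^m
    vanishes unless k <= m componentwise, which forces k = m, and d^[m] x^m = 1. *)
Lemma act_inj x y : act x =1 act y -> x = y.
Proof.
move=> eq_xy; apply/eqP; rewrite -subr_eq0; set z := x - y.
have act_z b : act z b = 0.
  by apply: (addIr (act y b)); rewrite -actDl subrK add0r eq_xy.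
apply/eqP; apply: contraTeq isT => nz_z.
have [sm le_m] := (mlast_supp nz_z, @mlast_lemc _ _ ^~ z); set m := mlast z in sm le_m.
have := act_z (1 *: 'X_[m]); rewrite /act /msum (bigD1_seq m) ?msupp_uniq //= big1_seq ?addr0.
  rewrite dactZX /mbinom big1 => [|i _]; last by rewrite binn.
  rewrite mulr1 -[(m - m)%MM](_ : 0%MM = _); last by apply/mnmP => i; rewrite mnmBE subnn mnm0E.
  by rewrite mpolyX0 scale1r mulr1 => /eqP; rewrite mcoeff_eq0 sm.
move=> k /andP[ne_km sk]; rewrite dactZX mbinom_eq0 ?mulr0 ?scale0r ?mulr0 //.
apply: contra ne_km => /lem_leo le_km; apply/eqP/le_anti.
by rewrite le_km le_m.
Qed.

Definition dmul_term g h a b : D :=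
  \sum_(k : 'X_{1..n < (mdeg g).+1} | (bmnm k <= g)%MM)
    ((a * dact k b) * (mbin (g - k)%MM h)%:R) *: 'X_[(g - k) + h].

Lemma dmul_termDl g h b : {morph (dmul_term g h)^~ b : a a' / a + a'}.
Proof.
by move=> a a'; rewrite -big_split; apply: eq_bigr => k _; rewrite !mulrDl scalerDl.
Qed.

Lemma dmul_termDr g h a : {morph dmul_term g h a : b b' / b + b'}.
Proof.
move=> b b'; rewrite -big_split; apply: eq_bigr => k _.
by rewrite dactD mulrDr mulrDl scalerDl.
Qed.

Lemma dmulE x y :
  dmul x y = msum (fun g a => msum (fun h b => dmul_term g h a b) y) x.
Proof. by []. Qed.

Lemma msum_dmul_termD y g :
  {morph (fun a => msum (fun h b => dmul_term g h a b) y) : a a' / a + a'}.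
Proof.
by move=> a a'; apply: msum_split => h b; apply: dmul_termDl.
Qed.

Lemma dmulDl : left_distributive (@dmul K n) +%R.
Proof. by move=> x y z; rewrite !dmulE msumD //; apply: msum_dmul_termD. Qed.

Lemma dmulDr : right_distributive (@dmul K n) +%R.
Proof.
move=> x y z; rewrite !dmulE; apply: msum_split => g a.
by rewrite msumD // => h; apply: dmul_termDr.
Qed.

Lemma dmulZX a b g h : dmul (a *: 'X_[g]) (b *: 'X_[h]) = dmul_term g h a b.
Proof.
rewrite dmulE msumZX; first by rewrite msumZX // => k; apply: dmul_termDr.
exact: msum_dmul_termD.
Qed.

(** On single terms this is the Leibniz rule [dactM] followed by the composition law [dact_dact]. *)
Lemma act_dmul x y b : act (dmul x y) b = act x (act y b).
Proof.
elim/mpoly_add_ind: x y => [x x' IHx IHx'|c g] y.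
  by rewrite dmulDl !actDl IHx IHx'.
elim/mpoly_add_ind: y => [y y' IHy IHy'|d h].
  by rewrite dmulDr !actDl IHy IHy' actDr.
have act0 : act 0 b = 0 by rewrite /act /msum msupp0 big_nil.
rewrite dmulZX /dmul_term (big_morph (act^~ b) (fun x y => actDl x y b) act0).
rewrite !actZX dactM mulr_sumr.
apply: eq_bigr => k _; rewrite actZX dact_dact -!mulrA; congr (_ * (_ * _)).
by rewrite mulr_natl.
Qed.

Lemma act1 b : act 1 b = b.
Proof.
rewrite -mpolyX0 -[X in act X _]scale1r actZX mul1r.
elim/mpoly_add_ind: b => [b c IHb IHc|c m]; first by rewrite dactD IHb IHc.
by rewrite dactZX subm0 /mbinom big1 ?mulr1 // => i _; rewrite mnm0E bin0.
Qed.

Lemma dmulA : associative (@dmul K n).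
Proof. by move=> x y z; apply: act_inj => b; rewrite !act_dmul. Qed.

Lemma dmul1l : left_id 1 (@dmul K n).
Proof. by move=> x; apply: act_inj => b; rewrite act_dmul act1. Qed.

Lemma dmul1r : right_id 1 (@dmul K n).
Proof. by move=> x; apply: act_inj => b; rewrite act_dmul act1. Qed.

End Operators.

(** * Scalars and the K-algebra structure *)

Section Scalars.
Variables (K : fieldType) (n : nat).
Local Notation P := {mpoly K[n]}.
Local Notation D := {mpoly P[n]}.
Implicit Types (a b c : P) (x y z : D) (g h m : 'X_{1..n}).

Lemma actZ a x b : act (a *: x) b = a * act x b.
Proof.
elim/mpoly_add_ind: x => [x y IHx IHy|c m].
  by rewrite scalerDr !actDl IHx IHy mulrDr.
by rewrite scalerA !actZX mulrA.
Qed.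

Lemma dmulCl a x : dmul a%:MP x = a *: x.
Proof.
by apply: act_inj => b; rewrite act_dmul -alg_mpolyC !actZ act1.
Qed.

Lemma act_scale x (c : K) b : act x (c%:MP * b) = c%:MP * act x b.
Proof.
elim/mpoly_add_ind: x => [x y IHx IHy|d m]; first by rewrite !actDl IHx IHy mulrDr.
rewrite !actZX mulrCA; congr (_ * _).
elim/mpoly_add_ind: b => [b b' IHb IHb'|e k]; first by rewrite mulrDr !dactD IHb IHb' mulrDr.
by rewrite !mul_mpolyC scalerA !dactZX -mulrA scalerA.
Qed.

Lemma dscalE (c : K) x : dscal c x = dmul (c%:MP%:MP) x.
Proof. by rewrite dmulCl. Qed.

Lemma dscalAl (c : K) x y : dscal c (dmul x y) = dmul (dscal c x) y.
Proof. by rewrite !dscalE dmulA. Qed.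

Lemma dscalAr (c : K) x y : dscal c (dmul x y) = dmul x (dscal c y).
Proof. by apply: act_inj => b; rewrite /dscal !(actZ, act_dmul) act_scale. Qed.

Lemma dscalA (c d : K) x : dscal c (dscal d x) = dscal (c * d) x.
Proof. by rewrite /dscal scalerA mpolyCM. Qed.

Lemma dscal1 : left_id 1 (@dscal K n).
Proof. by move=> x; rewrite /dscal mpolyC1 scale1r. Qed.

Lemma dscalDr : right_distributive (@dscal K n) +%R.
Proof. by move=> c x y; apply: scalerDr. Qed.

Lemma dscalDl x : {morph (@dscal K n)^~ x : c d / c + d}.
Proof. by move=> c d; rewrite /dscal mpolyCD scalerDl. Qed.

End Scalars.

(** The same carrier under a new name, so that it can bear the product [dmul] and the K-scalars
    [dscal] beside the commutative ring structure of [mpoly]. *)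
Definition diffop (K : fieldType) (n : nat) : Type := {mpoly {mpoly K[n]}[n]}.

HB.instance Definition _ (K : fieldType) (n : nat) := GRing.Zmodule.on (diffop K n).
HB.instance Definition _ (K : fieldType) (n : nat) := GRing.Zmodule_isNzRing.Build (diffop K n)
  (@dmulA K n) (@dmul1l K n) (@dmul1r K n) (@dmulDl K n) (@dmulDr K n)
  (oner_neq0 {mpoly {mpoly K[n]}[n]}).
HB.instance Definition _ (K : fieldType) (n : nat) := GRing.Zmodule_isLmodule.Build K (diffop K n)
  (@dscalA K n) (@dscal1 K n) (@dscalDr K n) (@dscalDl K n).
HB.instance Definition _ (K : fieldType) (n : nat) :=
  GRing.Lmodule_isLalgebra.Build K (diffop K n) (@dscalAl K n).
HB.instance Definition _ (K : fieldType) (n : nat) :=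
  GRing.Lalgebra_isAlgebra.Build K (diffop K n) (@dscalAr K n).

(** * Relations in D(P_n) and the commutative subring D_n *)

Section DiffopTheory.
Variables (K : fieldType) (n : nat).
Local Notation P := {mpoly K[n]}.
Local Notation D := (diffop K n).
Implicit Types (a b : P) (c : K) (x y z : D) (g h m : 'X_{1..n}).

(* [fop a] is the multiplication operator by [a], and [del g] is the divided
   power d^[g]. *)
Definition fop (a : P) : D := a%:MP.
Definition del (g : 'X_{1..n}) : D := 'X_[g].

Lemma dexpE x k : dexp x k = x ^+ k.
Proof. by elim: k => // k IHk; rewrite exprS -IHk. Qed.

Lemma fopD : {morph fop : a b / a + b}.
Proof. exact: mpolyCD. Qed.

Lemma fop1 : fop 1 = 1.
Proof. by rewrite /fop mpolyC1. Qed.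

Lemma fopM : {morph fop : a b / a * b >-> a * b}.
Proof.
by move=> a b; rewrite -[RHS]/(dmul a%:MP b%:MP) dmulCl -mul_mpolyC /fop mpolyCM.
Qed.

Lemma fop_scale c : fop c%:MP = c%:A.
Proof. by rewrite -[RHS]/(c%:MP *: (1 : {mpoly P[n]})) alg_mpolyC. Qed.

Lemma fop_del a g : fop a * del g = a *: ('X_[g] : {mpoly P[n]}).
Proof. exact: dmulCl. Qed.

Lemma diffop_ind (Q : D -> Prop) :
    (forall x y, Q x -> Q y -> Q (x + y)) -> (forall a g, Q (fop a * del g)) ->
  forall x, Q x.
Proof. by move=> QD Qm; apply: mpoly_add_ind => // c m; rewrite -fop_del. Qed.

Lemma del0 : del 0%MM = 1.
Proof. exact: mpolyX0. Qed.

Lemma delM g h : del g * del h = del (g + h)%MM *+ mbin g h.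
Proof.
apply: act_inj => b; rewrite -[del g * _]/(dmul 'X_[g] 'X_[h]) act_dmul.
have actX k b' : act 'X_[k] b' = dact k b'.
  by rewrite -[X in act X]scale1r actZX mul1r.
rewrite !actX dact_dact -(actX (g + h)%MM) /del.
elim: mbin => [|k IHk]; first by rewrite !mulr0n /act /msum msupp0 big_nil.
by rewrite !mulrSr actDl -IHk.
Qed.

Lemma del_mul_fop q g j :
    (forall k l : nat, 'C(k + q, l)%:R = 'C(k, l)%:R + ('C(k, l - q) * (q <= l))%:R :> K) ->
  del g * fop ('X_j ^+ q) =
    fop ('X_j ^+ q) * del g + del (g - U_(j) *+ q)%MM *+ (q <= g j).
Proof.
move=> binq; apply: act_inj => b; rewrite fop_del actDl.
rewrite -[del g * _]/(dmul 'X_[g] ('X_j ^+ q)%:MP) act_dmul.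
have actX k b' : act 'X_[k] b' = dact k b'.
  by rewrite -[X in act X]scale1r actZX mul1r.
rewrite -alg_mpolyC !actZ act1 !actX dact_mulXn //; congr (_ + _).
by case: leqP => _; rewrite ?mulr1n ?mulr0n ?actX // /act /msum msupp0 big_nil.
Qed.

Lemma isDnD x y : isDn x -> isDn y -> isDn (x + y).
Proof. by move=> Dx Dy m; rewrite !mcoeffD mpolyCD -Dx -Dy. Qed.

Lemma isDn_ZX c g : isDn (c *: del g).
Proof.
move=> m; rewrite -[c *: _]/(c%:MP *: ('X_[g] : {mpoly P[n]})) mcoeffZ mcoeffX.
by case: eqP => _; rewrite ?mulr1 ?mulr0 ?mcoeff0 ?mpolyC0 // mpolyCK.
Qed.

Lemma isDn_sumE x : isDn x -> x = \sum_(m <- msupp x) (x@_m)@_0%MM *: del m.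
Proof.
by move=> Dx; rewrite {1}[x]mpolyE; apply: eq_bigr => m _; rewrite {1}Dx.
Qed.

Lemma isDn_ind (Q : D -> Prop) :
    (forall x y, Q x -> Q y -> Q (x + y)) -> (forall c g, Q (c *: del g)) ->
  forall x, isDn x -> Q x.
Proof.
move=> QD Qm x /isDn_sumE ->; apply: big_ind => //.
by rewrite -(scale0r (del 0%MM)).
Qed.

Lemma isDnZ c x : isDn x -> isDn (c *: x).
Proof.
move: x; apply: isDn_ind => [x y|d g]; first by rewrite scalerDr; apply: isDnD.
by rewrite scalerA; apply: isDn_ZX.
Qed.

Lemma isDn1 : isDn (1 : D).
Proof. by rewrite -del0 -[del _]scale1r; apply: isDn_ZX. Qed.

Lemma isDnM x y : isDn x -> isDn y -> isDn (x * y).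
Proof.
move=> Dx; move: y; apply: isDn_ind => [y z|d h]; first by rewrite mulrDr; apply: isDnD.
rewrite -scalerAr; apply: isDnZ.
move: x Dx; apply: isDn_ind => [x y|c g]; first by rewrite mulrDl; apply: isDnD.
by rewrite -scalerAl; apply: isDnZ; rewrite delM -scaler_nat; apply: isDn_ZX.
Qed.

Lemma isDnX x k : isDn x -> isDn (x ^+ k).
Proof. by move=> Dx; elim: k => [|k IHk]; rewrite ?exprS; [apply: isDn1 | apply: isDnM]. Qed.

Lemma isDn_intstar i k x : isDn x -> isDn (intstar i k x).
Proof.
move: x; apply: isDn_ind => [x y|c g].
  by rewrite /intstar mulrDl; apply: isDnD.
rewrite /intstar -[c *: _]/(c%:MP *: ('X_[g] : {mpoly P[n]})) -scalerAl mpolyXn -mpolyXD.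
exact: isDn_ZX.
Qed.

Lemma isDn_comm x y : isDn x -> isDn y -> x * y = y * x.
Proof.
move=> Dx Dy; move: y Dy; apply: isDn_ind => [y z IHy IHz|d h].
  by rewrite mulrDr IHy IHz mulrDl.
rewrite -scalerAr -scalerAl; congr (_ *: _).
move: x Dx; apply: isDn_ind => [x y IHx IHy|c g].
  by rewrite mulrDl IHx IHy mulrDr.
rewrite -scalerAr -scalerAl; congr (_ *: _); rewrite !delM addmC; congr (_ *+ _).
by apply: eq_bigr => i _; rewrite [in RHS]addnC -(bin_sub (leq_addr (h i) (g i))) addKn.
Qed.

(** * Characteristic p: nilpotent elements of D_n and commutators with powers of x_j *)

Variables (p : nat) (hp : p \in [pchar K]).

(** The power is an integer multiple of d^[p g], and the integer is divisible by 'C(p g_i, g_i) for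
    an i with g_i > 0, hence by p. *)
Lemma del_exp_pchar g : g != 0%MM -> del g ^+ p = 0.
Proof.
move=> nz_g; have p_gt0 := prime_gt0 (pcharf_prime hp).
have expE k : exists e, del g ^+ k = del (g *+ k)%MM *+ e.
  elim: k => [|k [e IHk]]; first by exists 1%N; rewrite mulm0n del0.
  by exists (mbin g (g *+ k)%MM * e)%N; rewrite exprS IHk mulrnAr delM -mulrnA mulmS.
have [i nz_gi] := mnm_neq0 nz_g.
have [e def_e] := expE p.-1; rewrite -(prednK p_gt0) exprS def_e mulrnAr delM -mulrnA.
suff /dvdnP[d ->] : (p %| mbin g (g *+ p.-1)%MM)%N.
  by rewrite -scaler_nat !natrM (pcharf0 hp) mulr0 mul0r scale0r.
rewrite /mbin (bigD1 i) //= dvdn_mulr // mulmnE -mulnS prednK //.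
have -> : (g i * p.-1 = g i * p - g i)%N by rewrite -subn1 mulnBr muln1.
rewrite bin_sub ?leq_pmulr //.
have a_gt0 : (0 < g i)%N by rewrite lt0n.
(* From a 'C(a p, a) = a p 'C(a p - 1, a - 1), cancelling a = g_i exhibits the factor p. *)
have E := mul_bin_diag (g i * p) (g i).-1; rewrite prednK // in E.
have -> : 'C(g i * p, g i) = (p * 'C((g i * p).-1, (g i).-1))%N.
  by apply/eqP; rewrite -(eqn_pmul2l a_gt0) mulnA -E.
exact: dvdn_mulr.
Qed.

(** D_n is commutative of characteristic p, so p-th powers are additive on it and each term is
    handled by [del_exp_pchar]. *)
Lemma isDn_exp_pchar x : isDn x -> x@_0%MM = 0 -> x ^+ p = 0.
Proof.
move=> Dx x0.
have hpD : p \in [pchar D] by rewrite pchar_lalg.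
(* Membership in D_n is carried along because additivity of Frobenius needs commuting summands. *)
suff [] : isDn x /\ x ^+ p = 0 by [].
rewrite (isDn_sumE Dx) big_seq; apply: (big_ind (fun z => isDn z /\ z ^+ p = 0)).
- split; last by rewrite expr0n -(prednK (prime_gt0 (pcharf_prime hp))).
  by rewrite -(scale0r (del 0%MM)); apply: isDn_ZX.
- move=> y z [Dy y0] [Dz z0]; split; first exact: isDnD.
  rewrite -(pFrobenius_autE hpD) pFrobenius_autD_comm; last exact: isDn_comm.
  by rewrite !pFrobenius_autE y0 z0 addr0.
move=> m mx; split; first exact: isDn_ZX.
rewrite exprZn del_exp_pchar ?scaler0 //; apply: contraTneq mx => ->.
by rewrite mcoeff_msupp x0 eqxx.
Qed.

(* Writing [x = c + z] with [z] of constant term 0, Frobenius gives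
   [x ^+ p = c ^+ p]. *)
Lemma isDn_coef0_nilp x : isDn x -> x ^+ p = 0 -> x@_0%MM = 0.
Proof.
move=> Dx xp0; set c := (x@_0%MM)@_0%MM; pose z := x + (- c) *: 1.
have hpD : p \in [pchar D] by rewrite pchar_lalg.
have D1 d : isDn (d *: 1 : D) by apply/isDnZ/isDn1.
have Dz : isDn z by apply: isDnD.
have z0 : z@_0%MM = 0.
  rewrite mcoeffD Dx -/c -[_ *: 1]/((- c)%:MP *: (1 : {mpoly P[n]})) mcoeffZ mcoeff1.
  by rewrite eqxx mulr1 -mpolyCD subrr mpolyC0.
have := isDn_exp_pchar Dz z0; rewrite /z -(pFrobenius_autE hpD).
have cxc : GRing.comm x (- c *: 1) by apply: isDn_comm.
rewrite (pFrobenius_autD_comm hpD cxc) !pFrobenius_autE xp0 add0r.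
rewrite exprZn expr1n => /eqP; rewrite scaler_eq0 oner_eq0 orbF expf_eq0 oppr_eq0.
by case/andP => _ /eqP c0; rewrite Dx -/c c0 mpolyC0.
Qed.

Definition bracket (q : nat) (j : 'I_n) x : D := x * fop ('X_j ^+ q) - fop ('X_j ^+ q) * x.

(** Coefficients in P_n commute with x_j^(p^s), and [bin_addn_pexp] leaves at most one term in the
    commutator of d^[g]; the bracket is thus a shift of coefficients. *)
Lemma mcoeff_bracket s j x m :
  (bracket (p ^ s) j x)@_m = x@_(m + U_(j) *+ p ^ s)%MM.
Proof.
have bracketD y z : bracket (p ^ s) j (y + z) = bracket (p ^ s) j y + bracket (p ^ s) j z.
  by rewrite /bracket mulrDl mulrDr opprD addrACA.
elim/diffop_ind: x => [x y IHx IHy|a g]; first by rewrite bracketD [RHS]mcoeffD -IHx -IHy -mcoeffD.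
have -> : bracket (p ^ s) j (fop a * del g) = fop a * bracket (p ^ s) j (del g).
  by rewrite /bracket mulrBr !mulrA -!fopM [(a * _)%R]mulrC.
rewrite /bracket del_mul_fop; last exact: bin_addn_pexp.
rewrite addrC addKr mulrnAr !fop_del mcoeffMn !mcoeffZ !mcoeffX.
case: leqP => le_q.
  congr (_ * (_ : bool)%:R); apply/eqP/eqP => [<-|->]; last by rewrite addmK.
  by rewrite submK // lem_U1n.
rewrite mulr0n; case: eqP => [eq_g|_]; last by rewrite mulr0.
by move: le_q; rewrite eq_g mnmDE mulmnE mnm1E eqxx mul1n ltnNge leq_addl.
Qed.

Lemma bracketP q j x : x * fop ('X_j ^+ q) = fop ('X_j ^+ q) * x + bracket q j x.
Proof. by rewrite addrC subrK. Qed.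

Lemma bracket_intstar s j x : bracket (p ^ s) j (intstar j (p ^ s) x) = x.
Proof.
by apply/mpolyP => m; rewrite mcoeff_bracket /intstar mpolyXn addmC mcoeffMX.
Qed.

Lemma bracket_intstar_neq s i j x : i != j ->
  bracket (p ^ s) j (intstar i (p ^ s) x) = intstar i (p ^ s) (bracket (p ^ s) j x).
Proof.
move=> ne_ij; apply/mpolyP => m; rewrite mcoeff_bracket /intstar mpolyXn !mcoeffMXn mcoeff_bracket.
have -> : (U_(i) *+ p ^ s <= m + U_(j) *+ p ^ s)%MM = (U_(i) *+ p ^ s <= m)%MM.
  by rewrite !lem_U1n mnmDE mulmnE mnm1E eq_sym (negPf ne_ij) addn0.
case: (boolP (U_(i) *+ p ^ s <= m)%MM) => [/mnm_lepP le_m|_]; last by rewrite !mulr0n.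
rewrite !mulr1n; congr mcoeff; apply/mnmP => l.
by rewrite !(mnmBE, mnmDE) addnBAC //; apply: le_m.
Qed.

End DiffopTheory.

Arguments del {K n} g.

(** * Frobenius endomorphisms *)

(** Leibniz rule for the commutator with w when only the factor at j may fail to commute with w; F'
    is F with that factor replaced by its commutator. *)
Lemma prod_commutator (R : nzRingType) (I : eqType) (r : seq I) (F F' : I -> R) (w : R) (j : I) :
    uniq r -> j \in r ->
    F j * w = w * F j + F' j ->
    (forall i, i != j -> F i * w = w * F i /\ F' i = F i) ->
  (\prod_(i <- r) F i) * w = w * (\prod_(i <- r) F i) + \prod_(i <- r) F' i.
Proof.
move=> uniq_r jr Fj Fi; have Fr (t : seq I) : j \notin t ->
    (\prod_(i <- t) F i) * w = w * (\prod_(i <- t) F i) /\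
    \prod_(i <- t) F' i = \prod_(i <- t) F i.
  elim: t => [|i t IHt]; first by rewrite !big_nil mulr1 mul1r.
  rewrite inE negb_or eq_sym => /andP[ne_ij /IHt[IH1 IH2]]; have [Fiw F'i] := Fi _ ne_ij.
  by rewrite !big_cons -mulrA IH1 IH2 F'i !mulrA Fiw.
elim: r uniq_r jr => // i r IHr /= /andP[nir uniq_r]; rewrite inE !big_cons.
have [eq_ji _|ne_ij /= jr] := eqVneq j i.
  rewrite -eq_ji in nir *.
  have [F1 F2] := Fr r nir.
  by rewrite -mulrA F1 F2 mulrA Fj mulrDl mulrA.
have [|Fiw F'i] := Fi i; first by rewrite eq_sym.
by rewrite -mulrA IHr // mulrDr !mulrA Fiw F'i.
Qed.

Section FrobeniusLifts.
Variables (K : fieldType) (p : nat) (hp : p \in [pchar K]) (n s : nat).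
Local Notation P := {mpoly K[n]}.
Local Notation D := (diffop K n).
Local Notation q := (p ^ s)%N.
Implicit Types (a b : P) (c : K) (x y z : D) (g h m : 'X_{1..n}).

Let p_gt0 : (0 < p)%N := prime_gt0 (pcharf_prime hp).
Let q_gt0 : (0 < q)%N. Proof. by rewrite expn_gt0 p_gt0. Qed.

Lemma exprDn_q a b : (a + b) ^+ q = a ^+ q + b ^+ q.
Proof.
apply: exprDn_pchar; rewrite pnatX; apply/orP; left.
by rewrite pnatE ?(pcharf_prime hp) // pchar_lalg.
Qed.

Lemma mul_fop_C x c : x * fop c%:MP = fop c%:MP * x.
Proof. by rewrite fop_scale mulr_algr mulr_algl. Qed.

Lemma del_mul_X g j :
  del g * fop 'X_j = fop ('X_j : P) * del g + del (g - U_(j))%MM *+ (0 < g j)%N.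
Proof.
have := @del_mul_fop K n 1 g j; rewrite expr1 mulm1n; apply => k l.
by have := bin_addn_pexp hp 0 k l; rewrite expn0.
Qed.

(** * Extending a |-> a^q to an endomorphism *)

Section Extension.
Variable Y : 'X_{1..n} -> D.
Hypothesis Y0 : Y 0%MM = 1.
Hypothesis YM : forall g h, Y g * Y h = Y (g + h)%MM *+ mbin g h.
Hypothesis Ybracket : forall g j,
  Y g * fop ('X_j ^+ q) = fop ('X_j ^+ q) * Y g + Y (g - U_(j))%MM *+ (0 < g j)%N.

(** Y g is the image prescribed for d^[g]; [YM] and [Ybracket] are the images of the relations
    [delM] and [del_mul_X]. *)
Definition frob_ext : D -> D := msum (fun g a => fop (a ^+ q) * Y g).

Lemma frob_extD : {morph frob_ext : x y / x + y}.
Proof. by apply: msumD => g a b; rewrite exprDn_q fopD mulrDl. Qed.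

Lemma frob_ext_del a g : frob_ext (fop a * del g) = fop (a ^+ q) * Y g.
Proof. by rewrite fop_del; apply: msumZX => h b d; rewrite exprDn_q fopD mulrDl. Qed.

Lemma frob_extMn x k : frob_ext (x *+ k) = frob_ext x *+ k.
Proof.
have ext0 : frob_ext 0 = 0 by apply: (addrI (frob_ext 0)); rewrite -frob_extD !addr0.
by elim: k => [|k IHk]; rewrite ?mulr0n // !mulrS frob_extD IHk.
Qed.

Lemma frob_ext_fopl a x : frob_ext (fop a * x) = fop (a ^+ q) * frob_ext x.
Proof.
elim/diffop_ind: x => [x y IHx IHy|b g]; first by rewrite mulrDr !frob_extD IHx IHy mulrDr.
by rewrite mulrA -fopM !frob_ext_del exprMn fopM mulrA.
Qed.

Lemma frob_ext_del1 g : frob_ext (del g) = Y g.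
Proof. by rewrite -[del g]mul1r -fop1 frob_ext_del expr1n fop1 mul1r. Qed.

Lemma frob_ext_fopX x i : frob_ext (x * fop 'X_i) = frob_ext x * fop ('X_i ^+ q).
Proof.
elim/diffop_ind: x => [x y IHx IHy|a g]; first by rewrite mulrDl !frob_extD IHx IHy mulrDl.
rewrite -mulrA del_mul_X !frob_ext_fopl frob_extD frob_ext_fopl frob_extMn.
by rewrite !frob_ext_del1 -Ybracket mulrA.
Qed.

(* The [b] satisfying this for every [x] form a subring of [P_n], so it is enough
   to treat the constants and the variables. *)
Lemma frob_ext_fopr x b : frob_ext (x * fop b) = frob_ext x * fop (b ^+ q).
Proof.
elim/mpolyX_ind: b x => [b b' IHb IHb'|c|i b IHb] x.
- by rewrite fopD mulrDr frob_extD IHb IHb' exprDn_q fopD mulrDr.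
- by rewrite mul_fop_C frob_ext_fopl -rmorphXn /= -mul_fop_C.
rewrite (fopM 'X_i b) mulrA IHb frob_ext_fopX exprMn.
by rewrite (fopM ('X_i ^+ q) (b ^+ q)) mulrA.
Qed.

Lemma frob_extM x y : frob_ext (x * y) = frob_ext x * frob_ext y.
Proof.
elim/diffop_ind: y => [y z IHy IHz|b h]; first by rewrite mulrDr !frob_extD IHy IHz mulrDr.
(* The function b is absorbed into the left factor, so that only right multiplication by d^[h]
   remains. *)
rewrite mulrA frob_ext_del [RHS]mulrA -frob_ext_fopr; move: (x * fop b) => {}x.
elim/diffop_ind: x => [x z IHx IHz|a g]; first by rewrite mulrDl !frob_extD IHx IHz mulrDl.
by rewrite -mulrA delM mulrnAr frob_extMn !frob_ext_del -mulrA YM mulrnAr.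
Qed.

Lemma frob_ext_fop a : frob_ext (fop a) = fop (a ^+ q).
Proof. by rewrite -[fop a]mulr1 -del0 frob_ext_del Y0 mulr1. Qed.

End Extension.

(** * The system y_u and its commutation relations *)

Section FromMatrix.
Variable u : 'I_n -> nat -> D.
Local Notation ypkD i := (ypk p s u i : nat -> D).

(** One recursion for all k: the product is y^[p^k - 1], and for k = 0 it is 1, whose integral is
    d_i^[q]. *)
Lemma ypkE i k :
  ypk p s u i k = u i k + intstar i q (digit_prod p (ypkD i) k (p ^ k).-1) :> D.
Proof.
have yseqE l : yseq p s u i l = mkseq (ypk p s u i) l.+1.
  elim: l => [|l IHl] //; rewrite [RHS]mkseqS -IHl /ypk /=; congr rcons.
  by rewrite nth_rcons IHl size_mkseq ltnn eqxx.
case: k => [|k].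
  by rewrite expn0 digit_prod0 /intstar mul1r [RHS]addrC.
rewrite digit_prod_pexp_pred // /ypk /= yseqE nth_rcons size_mkseq ltnn eqxx.
congr (_ + intstar _ _ _); rewrite /mkseq big_map -[iota 0 k.+1]/(index_iota 0 k.+1).
by rewrite big_mkord; apply: eq_bigr => l _; rewrite dexpE.
Qed.

Lemma yjE i j : yj p s u i j = digit_prod p (ypkD i) j.+1 j :> D.
Proof. by apply: eq_bigr => k _; rewrite dexpE. Qed.

Lemma yj0 i : yj p s u i 0 = 1 :> D.
Proof. by rewrite yjE digit_prod0. Qed.

Lemma yj_pexp i k : yj p s u i (p ^ k) = ypk p s u i k :> D.
Proof.
rewrite yjE digit_prod_pexp // ltnS ltnW // ltn_expl //.
exact: prime_gt1 (pcharf_prime hp).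
Qed.

Lemma yj_digit_prod i j N : (j < p ^ N)%N ->
  yj p s u i j = digit_prod p (ypkD i) N j :> D.
Proof.
have p_gt1 := prime_gt1 (pcharf_prime hp).
have lt_j : (j < p ^ j.+1)%N.
  by apply: (ltn_trans (ltn_expl j p_gt1)); rewrite ltn_exp2l.
move=> ltjN; rewrite yjE; have [le_jN|/ltnW le_Nj] := leqP j.+1 N.
  exact: digit_prod_widen.
by apply/esym; apply: digit_prod_widen.
Qed.

Lemma yj_pexp_pred i k :
  yj p s u i (p ^ k).-1 = digit_prod p (ypkD i) k (p ^ k).-1 :> D.
Proof. by rewrite (@yj_digit_prod i _ k) // prednK // expn_gt0 p_gt0. Qed.

Hypothesis Mu : Mns p s u.

Lemma isDn_digit_prod (Z : nat -> D) N j :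
  (forall k, (k < N)%N -> isDn (Z k)) -> isDn (digit_prod p Z N j).
Proof.
move=> DZ; apply: (big_ind (@isDn K n)) => [|x y|k _]; [exact: isDn1 | exact: isDnM |].
by apply/isDnZ/isDnX/DZ.
Qed.

Lemma isDn_ypk i k : isDn (ypk p s u i k).
Proof.
have [N] := ubnP k; elim: N k => // N IHN k ltkN; rewrite ypkE.
apply: isDnD; first by have [] := Mu i k.
by apply/isDn_intstar/isDn_digit_prod => l ltlk; apply/IHN/(leq_trans ltlk).
Qed.

Lemma isDn_yj i j : isDn (yj p s u i j).
Proof. by rewrite yjE; apply: isDn_digit_prod => k _; apply: isDn_ypk. Qed.

(** The constant term vanishes: u_ik has none, and the integral raises the i-th exponent by q >
    0. *)
Lemma ypk_exp_pchar i k : (ypk p s u i k : D) ^+ p = 0.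
Proof.
apply: (isDn_exp_pchar hp); first exact: isDn_ypk.
rewrite ypkE mcoeffD /intstar mpolyXn mcoeffMXn.
have -> : (U_(i) *+ q <= 0)%MM = false by rewrite lem_U1n mnm0E leqNgt q_gt0.
rewrite mulr0n addr0; apply/eqP; apply: contraT => nz_u.
by have [_ /(_ _ nz_u)[]] := Mu i k; rewrite eqxx.
Qed.

Lemma divided_powers_yj i : divided_powers (yj p s u i : nat -> D).
Proof.
have [d0 dM] : divided_powers (fun j => digit_prod p (ypkD i) j.+1 j : D).
  apply: (divided_powers_digit_prod hp) => [k l|k]; last exact: ypk_exp_pchar.
  by apply: isDn_comm; apply: isDn_ypk.
by split=> [|j k]; rewrite !yjE.
Qed.

(** All exponents in u_ik are below q, whereas the bracket reads coefficients at exponents at least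
    q. *)
Lemma bracket_u i j k : bracket q j (u i k) = 0.
Proof.
apply/mpolyP => m; rewrite (mcoeff_bracket hp) mcoeff0; apply/eqP; apply: contraT => nz_u.
have [_ /(_ _ nz_u)[_ /(_ j)]] := Mu i k.
by rewrite mnmDE mulmnE mnm1E eqxx mul1n ltnNge leq_addl.
Qed.

Lemma bracketD j x y : bracket q j (x + y) = bracket q j x + bracket q j y.
Proof. by rewrite /bracket mulrDl mulrDr opprD addrACA. Qed.

Lemma bracket_ypk i k :
  bracket q i (ypk p s u i k) = digit_prod p (ypkD i) k (p ^ k).-1.
Proof. by rewrite {1}ypkE bracketD bracket_u add0r (bracket_intstar hp). Qed.

Lemma bracket0P j x : bracket q j x = 0 <-> fop ('X_j ^+ q) * x = x * fop ('X_j ^+ q).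
Proof. by rewrite /bracket; split=> [/subr0_eq //|->]; rewrite subrr. Qed.

(** Strong induction on k: the bracket at j commutes with the integral at i and kills a product of
    the y^[p^l] with l < k. *)
Lemma bracket_ypk_neq i j k : i != j -> bracket q j (ypk p s u i k) = 0.
Proof.
move=> ne_ij; have [N] := ubnP k; elim: N k => // N IHN k ltkN.
rewrite ypkE bracketD bracket_u add0r (bracket_intstar_neq hp) //.
rewrite (_ : bracket q j _ = 0) ?/intstar ?mul0r //; apply/bracket0P.
apply: comm_digit_prod => l ltlk; apply/bracket0P/IHN.
exact: leq_trans ltlk _.
Qed.

(** Only indices p^k need checking; there the bracket kills u_ik and undoes the integral, leaving
    y^[p^k - 1]. *)
Lemma yj_bracket i j : (0 < j)%N ->
  (yj p s u i j : D) * fop ('X_i ^+ q) = fop ('X_i ^+ q) * yj p s u i j + yj p s u i j.-1.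
Proof.
apply: (divided_powers_commutator hp (divided_powers_yj i)) => k.
by rewrite yj_pexp yj_pexp_pred bracketP bracket_ypk.
Qed.

Lemma yj_comm i j l : i != j ->
  (yj p s u i l : D) * fop ('X_j ^+ q) = fop ('X_j ^+ q) * yj p s u i l.
Proof.
move=> ne_ij; rewrite yjE; apply/esym/comm_digit_prod => k _.
exact/bracket0P/bracket_ypk_neq.
Qed.

Lemma yalphaE g : yalpha p s u g = \prod_(i < n) (yj p s u i (g i) : D).
Proof. by []. Qed.

Lemma yalpha0 : yalpha p s u 0%MM = 1 :> D.
Proof. by rewrite yalphaE; apply: big1 => i _; rewrite mnm0E yj0. Qed.

Lemma isDn_yalpha g : isDn (yalpha p s u g).
Proof.
apply: (big_ind (@isDn K n)) => [|x y|i _]; [exact: isDn1 | exact: isDnM |].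
exact: isDn_yj.
Qed.

Lemma yalphaM g h :
  (yalpha p s u g : D) * yalpha p s u h = (yalpha p s u (g + h)%MM : D) *+ mbin g h.
Proof.
rewrite !yalphaE -prodrM_comm => [|i j _ _]; last by apply: isDn_comm; apply: isDn_yj.
rewrite /mbin -prodrMn; apply: eq_bigr => i _; rewrite (divided_powers_yj i).2 mnmDE.
by rewrite -(bin_sub (leq_addr (h i) (g i))) addKn.
Qed.

End FromMatrix.

(** Only the j-th factor can fail to commute with x_j^q, and it is 1 if g_j = 0. *)
Lemma yalpha_bracket (u : 'I_n -> nat -> D) g j : Mns p s u ->
  (yalpha p s u g : D) * fop ('X_j ^+ q) =
    fop ('X_j ^+ q) * yalpha p s u g + (yalpha p s u (g - U_(j))%MM : D) *+ (0 < g j)%N.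
Proof.
move=> Mu. have [gj0|gj_gt0] := posnP (g j).
  rewrite mulr0n addr0 yalphaE; apply/commr_sym/commr_prod => i _.
  rewrite /GRing.comm; have [->|ne_ij] := eqVneq i j; last by rewrite yj_comm.
  by rewrite gj0 yj0 mulr1 mul1r.
rewrite mulr1n !yalphaE; apply: (@prod_commutator _ _ _ _ _ _ j).
- exact: index_enum_uniq.
- exact: mem_index_enum.
- by rewrite (yj_bracket Mu) // mnmBE mnm1E eqxx subn1.
by move=> i ne_ij; rewrite yj_comm // mnmBE mnm1E eq_sym (negPf ne_ij) subn0.
Qed.

Lemma GuE (u : 'I_n -> nat -> D) : Gu p s u = frob_ext (yalpha p s u).
Proof. by []. Qed.

Lemma Gu_del (u : 'I_n -> nat -> D) g : Gu p s u (del g) = yalpha p s u g.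
Proof. by rewrite GuE frob_ext_del1. Qed.

Lemma Gu_Frob (u : 'I_n -> nat -> D) : Mns p s u -> Frob p s (Gu p s u).
Proof.
move=> Mu; rewrite GuE; set Y := yalpha p s u.
have Y0 : Y 0%MM = 1 by apply: yalpha0.
have YM g h : (Y g : D) * Y h = (Y (g + h)%MM : D) *+ mbin g h by apply: yalphaM.
have Yb g j : (Y g : D) * fop ('X_j ^+ q) =
    fop ('X_j ^+ q) * Y g + (Y (g - U_(j))%MM : D) *+ (0 < g j)%N.
  exact: yalpha_bracket.
have Ga a : frob_ext Y (fop a) = fop (a ^+ q) by apply: frob_ext_fop.
split; first exact: frob_extD.
split; first by move=> x y; apply: frob_extM.
split; first by rewrite -[1 in LHS](@fop1 K n) Ga expr1n fop1.
split.
  move=> x Px; have -> : x = fop x@_0%MM.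
    apply/mpolyP => m; rewrite mcoeffC; have [->|nz_m] := eqVneq; first by rewrite mulr1.
    by rewrite mulr0 Px.
  by rewrite Ga => m nz_m; rewrite mcoeffC (negPf nz_m) mulr0.
split; first exact: Ga.
apply: isDn_ind => [x y|c g]; first by rewrite frob_extD; apply: isDnD.
rewrite -mulr_algl -fop_scale frob_ext_del -rmorphXn /= fop_scale mulr_algl.
exact/isDnZ/isDn_yalpha.
Qed.

Lemma dd_del (i : 'I_n) k : dd K i k = del (U_(i) *+ k)%MM.
Proof. by rewrite /dd mpolyXn. Qed.

Lemma yalpha_single (u : 'I_n -> nat -> D) i k :
  yalpha p s u (U_(i) *+ k)%MM = yj p s u i k.
Proof.
rewrite yalphaE (@big_only1 _ _ _ _ i) //= => [|j ne_ji _].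
  by rewrite mulmnE mnm1E eqxx mul1n.
by rewrite mulmnE mnm1E eq_sym (negPf ne_ji) mul0n yj0.
Qed.

(** The values of G_u at d_i^[p^k] and d_i^[p^k - 1] are y^[p^k] and y^[p^k - 1], so this is the
    recursion [ypkE] solved for u_ik. *)
Lemma uG_Gu (u : 'I_n -> nat -> D) i k : uG p s (Gu p s u) i k = u i k.
Proof.
by rewrite /uG !dd_del !Gu_del !yalpha_single yj_pexp yj_pexp_pred ypkE addrK.
Qed.

Lemma divided_powers_del i : divided_powers (fun k => del (U_(i) *+ k)%MM : D).
Proof.
split=> [|j k]; first by rewrite mulm0n del0.
rewrite delM; congr (del _ *+ _).
  by apply/mnmP => l; rewrite mnmDE !mulmnE mulnDr.
rewrite /mbin (@big_only1 _ _ _ _ i) //= => [|l ne_li _].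
  by rewrite !mulmnE mnm1E eqxx !mul1n -(bin_sub (leq_addr k j)) addKn.
by rewrite !mulmnE mnm1E eq_sym (negPf ne_li) !mul0n bin0.
Qed.

Lemma del_prod g : del g = \prod_(i < n) (del (U_(i) *+ g i)%MM : D).
Proof.
rewrite {1}[g]multinomUE_id.
have : uniq (index_enum 'I_n) by apply: index_enum_uniq.
elim: (index_enum _) => [|i r IHr] /=; first by rewrite !big_nil del0.
case/andP=> nir uniq_r; rewrite !big_cons -IHr // delM.
(* The two exponents have disjoint supports, so every binomial is 1. *)
rewrite (_ : mbin _ _ = 1%N) //; apply: big1 => l _.
have [<-|ne_il] := eqVneq i l; last by rewrite mulmnE mnm1E (negPf ne_il) mul0n binn.
rewrite mnm_sumE big1_seq ?bin0 // => j /= jr; rewrite mulmnE mnm1E.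
by case: eqP jr nir => [->|] // ->.
Qed.

(** * The matrix of a Frobenius endomorphism *)

Section FromEndomorphism.
Variable G : D -> D.
Hypothesis FG : Frob p s G.

Let GD x y : G (x + y) = G x + G y. Proof. by case: FG => + _; apply. Qed.
Let GM x y : G (x * y) = G x * G y. Proof. by case: FG => _ [+ _]; apply. Qed.
Let G1 : G 1 = 1. Proof. by case: FG => _ [_ [+ _]]. Qed.
Let Gfop a : G (fop a) = fop (a ^+ q). Proof. by case: FG => _ [_ [_ [_ [+ _]]]]; apply. Qed.
Let GDn x : isDn x -> isDn (G x). Proof. by case: FG => _ [_ [_ [_ [_]]]]; apply. Qed.
Let G0 : G 0 = 0. Proof. by apply: (addrI (G 0)); rewrite -GD !addr0. Qed.
Let GMn x k : G (x *+ k) = G x *+ k.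
Proof. by elim: k => [|k IHk]; rewrite ?mulr0n // !mulrS GD IHk. Qed.

Let isDn_Gdel g : isDn (G (del g)).
Proof. by apply: GDn; rewrite -[del g]scale1r; apply: isDn_ZX. Qed.

Lemma divided_powers_G i : divided_powers (fun k => G (del (U_(i) *+ k)%MM)).
Proof.
have [d0 dM] := divided_powers_del i.
by split=> [|j k]; rewrite ?mulm0n ?del0 // -GM dM GMn.
Qed.

Lemma uGE i k :
  uG p s G i k = G (del (U_(i) *+ p ^ k)%MM)
                   - intstar i q (G (del (U_(i) *+ (p ^ k).-1)%MM)) :> D.
Proof. by rewrite /uG !dd_del. Qed.

(** Since G x_j = x_j^q, the bracket of G x is the image under G of the commutator of x with x_j. *)
Lemma bracket_Gdel i j k :
  bracket q j (G (del (U_(i) *+ k)%MM)) = G (del (U_(i) *+ k.-1)%MM) *+ ((i == j) && (0 < k))%N.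
Proof.
rewrite /bracket -Gfop -!GM del_mul_X GD addrC addKr GMn.
rewrite mulmnE mnm1E; have [<-|_] := eqVneq i j; last by rewrite mul0n.
rewrite mul1n; case: k => [|k]; first by rewrite !mulr0n.
congr (G (del _) *+ _); apply/mnmP => l.
by rewrite mnmBE !mulmnE mulnS addKn.
Qed.

(** For i = j the bracket undoes the integral and both terms become G(d_i^[p^k - 1]); for i <> j
    both vanish. *)
Lemma bracket_uG i j k : bracket q j (uG p s G i k) = 0.
Proof.
have bN x : bracket q j (- x) = - bracket q j x.
  by rewrite /bracket mulrN mulNr opprB addrC opprK.
rewrite uGE bracketD bN bracket_Gdel.
have [<-|ne_ij] := eqVneq i j.
  by rewrite (bracket_intstar hp) expn_gt0 p_gt0 mulr1n subrr.
by rewrite (bracket_intstar_neq hp) // bracket_Gdel (negPf ne_ij) mulr0n /intstar mul0r subr0.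
Qed.

(** The constant term is 0 because the p-th power of G(d_i^[p^k]) is G 0 = 0; the exponents stay
    below q because all brackets vanish. *)
Lemma Mns_uG : Mns p s (uG p s G).
Proof.
move=> i k; split.
  rewrite uGE -[- _](@scaleN1r K D); apply: isDnD; first exact: isDn_Gdel.
  exact/isDnZ/isDn_intstar/isDn_Gdel.
move=> m nz_m; split=> [|j].
  apply: contraNneq nz_m => ->.
  rewrite uGE mcoeffB /intstar mpolyXn mcoeffMXn.
  have -> : (U_(i) *+ q <= 0)%MM = false by rewrite lem_U1n mnm0E leqNgt q_gt0.
  rewrite mulr0n subr0 (isDn_coef0_nilp hp) //.
  have Gexp x l : G (x ^+ l) = G x ^+ l by elim: l => // l IHl; rewrite !exprS GM IHl.
  rewrite -Gexp (del_exp_pchar hp) //; apply/eqP => /mnmP/(_ i)/eqP.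
  by rewrite mulmnE mnm1E eqxx mul1n mnm0E expn_eq0 eqn0Ngt p_gt0.
rewrite ltnNge; apply: contra nz_m => le_q.
(* The coefficient at m is that of the j-th bracket at m - q e_j. *)
rewrite -(submK (_ : (U_(j) *+ q <= m)%MM)) ?lem_U1n //.
by rewrite -(mcoeff_bracket hp) bracket_uG mcoeff0.
Qed.

(** Strong induction on k: by [divided_powers_digits], G(d_i^[p^k - 1]) is the digit product of the
    G(d_i^[p^l]) with l < k, so both sides obey the same recursion. *)
Lemma ypk_uG i k : ypk p s (uG p s G) i k = G (del (U_(i) *+ p ^ k)%MM).
Proof.
have [N] := ubnP k; elim: N k => // N IHN k ltkN; rewrite ypkE uGE.
rewrite (divided_powers_digits hp (divided_powers_G i) (_ : (p ^ k).-1 < p ^ k)%N); last first.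
  by rewrite prednK // expn_gt0 p_gt0.
have -> : digit_prod p (ypk p s (uG p s G) i : nat -> D) k (p ^ k).-1 =
    digit_prod p (fun l => G (del (U_(i) *+ p ^ l)%MM)) k (p ^ k).-1.
  by apply: eq_bigr => l _; rewrite IHN // (leq_trans (ltn_ord l)).
exact: subrK.
Qed.

Lemma yj_uG i j : yj p s (uG p s G) i j = G (del (U_(i) *+ j)%MM).
Proof.
have p_gt1 := prime_gt1 (pcharf_prime hp).
have lt_j : (j < p ^ j.+1)%N.
  by apply: (ltn_trans (ltn_expl j p_gt1)); rewrite ltn_exp2l.
rewrite yjE (divided_powers_digits hp (divided_powers_G i) lt_j).
by apply: eq_bigr => l _; rewrite ypk_uG.
Qed.

Lemma yalpha_uG g : yalpha p s (uG p s G) g = G (del g).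
Proof.
rewrite yalphaE del_prod (big_morph G GM G1).
by apply: eq_bigr => i _; rewrite yj_uG.
Qed.

Lemma Gu_uG x : G x = Gu p s (uG p s G) x.
Proof.
rewrite GuE; elim/diffop_ind: x => [x y IHx IHy|a g]; first by rewrite GD IHx IHy frob_extD.
by rewrite GM Gfop frob_ext_del yalpha_uG.
Qed.

End FromEndomorphism.

End FrobeniusLifts.

Theorem theorem5p2 (K : fieldType) (p : nat) (hp : p \in [pchar K])
  (n s : nat) (hs : (1 <= s)%N) :
  (* G_u is the ring endomorphism with G_u(a)=a^{p^s}, G_u(d^[alpha]) = y_u^[alpha] *)
  (forall (u : 'I_n -> nat -> {mpoly {mpoly K[n]}[n]}), Mns p s u ->
     Frob p s (Gu p s u) /\ forall a : 'X_{1..n}, Gu p s u 'X_[a] = yalpha p s u a) /\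
  (* u |-> G_u is injective on M_{n,s}, with left inverse G |-> u(G) *)
  (forall (u : 'I_n -> nat -> {mpoly {mpoly K[n]}[n]}), Mns p s u ->
     forall i k, uG p s (Gu p s u) i k = u i k) /\
  (* and onto Frob_s, with u(G) in M_{n,s} and G = G_{u(G)} *)
  (forall G : {mpoly {mpoly K[n]}[n]} -> {mpoly {mpoly K[n]}[n]}, Frob p s G ->
     Mns p s (uG p s G) /\ forall x, G x = Gu p s (uG p s G) x).
Proof.
split=> [u Mu|]; first by split; [exact: Gu_Frob | move=> a; apply: (Gu_del hp)].
split=> [u _ i k|G FG]; first exact: uG_Gu.
by split; [exact: Mns_uG | exact: Gu_uG].
Qed.
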